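(* Let $(G,\mathbf p)$ be a bar framework with $n$ vertices whose configuration $\mathbf p$ has a $d$-dimensional affine span. If $(G,\mathbf p)$ is universally second-order rigid, then it has an equilibrium stress $\omega$ whose stress matrix $\Omega$ is positive semidefinite (acting on $\mathbb R^n$) and of rank $n-d-1$. Consequently $(G,\mathbf p)$ is super stable, and it is universally prestress stable.
   Context: A (bar) framework $(G,\mathbf p)$ in $\mathbb R^m$ is a finite graph $G$ with vertices $1,\dots,n$ together with a configuration $\mathbf p=(\mathbf p_1,\dots,\mathbf p_n)$, $\mathbf p_i\in\mathbb R^m$. A first-order flex in $\mathbb R^m$ is $\mathbf p'=(\mathbf p'_1,\dots,\mathbf p'_n)$, $\mathbf p_i'\in\mathbb R^m$, with $(\mathbf p_i-\mathbf p_j)\cdot(\mathbf p_i'-\mathbf p_j')=0$ for every edge $\{i,j\}$ of $G$. It is trivial if there are a skew-symmetric $m\times m$ matrix $A$ and $\mathbf b\in\mathbb R^m$ with $\mathbf p_i'=A\mathbf p_i+\mathbf b$ for all $i$. A second-order flex in $\mathbb R^m$ is a pair $(\mathbf p',\mathbf p'')$ of elements of $(\mathbb R^m)^n$ such that $\mathbf p'$ is a first-order flex and $(\mathbf p_i-\mathbf p_j)\cdot(\mathbf p_i''-\mathbf p_j'')+|\mathbf p_i'-\mathbf p_j'|^2=0$ for every edge $\{i,j\}$. The framework is second-order rigid in $\mathbb R^m$ if it has no second-order flex $(\mathbf p',\mathbf p'')$ in $\mathbb R^m$ with $\mathbf p'$ non-trivial. An equilibrium stress of $(G,\mathbf p)$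 is an assignment of scalars $\omega_{ij}=\omega_{ji}$ to the pairs of vertices, zero on non-edges, with $\sum_j\omega_{ij}(\mathbf p_i-\mathbf p_j)=0$ for every $i$. Its stress matrix $\Omega$ is the symmetric $n\times n$ matrix with $(i,j)$ entry $-\omega_{ij}$ for $i\ne j$ and all row and column sums zero. The framework is prestress stable in $\mathbb R^m$ if there is one equilibrium stress $\omega$ with $\sum_{i<j}\omega_{ij}|\mathbf p_i'-\mathbf p_j'|^2>0$ for every non-trivial first-order flex $\mathbf p'$ in $\mathbb R^m$. Universal versions: $\mathbf p$ is regarded as a configuration in $\mathbb R^D$ (via an inclusion of its ambient space in $\mathbb R^D$), where $D>d$ is a fixed, sufficiently large integer ($D\ge n$ suffices). Universally second-order rigid (resp. universally prestress stable) means second-order rigid (resp. prestress stable) in $\mathbb R^D$. The edge directions of a framework in $\mathbb R^D$ lie on a conic at infinity for the affine span $\langle\mathbf p\rangle$ if there is a symmetric $D\times D$ matrix $Q$ with $(\mathbf p_i-\mathbf p_j)^tQ(\mathbf p_i-\mathbf p_j)=0$ for all edges $\{i,j\}$ but $(\mathbf p_k-\mathbf p_l)^tQ(\mathbf p_k-\mathbf p_l)\neq0$ for some non-edge pair $\{k,l\}$. A framework whose affine span has dimension $d$ is super stable if it has an equilibrium stress whose stress matrix is positive semidefinite of rank $n-d-1$, and its edge directions do not lie on a conic at infinity for $\langle\mathbf p\rangle$. *)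

(* Defs.v *)
From HB Require Import structures.
From mathcomp Require Import all_boot all_order all_algebra.
From mathcomp Require Import reals.

Set Implicit Arguments.
Unset Strict Implicit.
Unset Printing Implicit Defensive.

Import Order.TTheory GRing.Theory Num.Theory.
Local Open Scope ring_scope.

Definition simple_graph (n : nat) (e : rel 'I_n) : Prop :=
  symmetric e /\ irreflexive e.

Definition configuration (R : realType) (n m : nat) : Type := 'I_n -> 'cV[R]_m.

(* The norm `|u| that the library puts on matrices is the sup norm, so the
   squared Euclidean norm is always written dot u u. *)
Definition dot (R : realType) (m : nat) (u v : 'cV[R]_m) : R :=
  (u^T *m v) 0 0.

(* The dimension of the affine span of p is the dimension of its direction
   space, which is spanned by the differences of the points of p.
   This is meaningful for n > 0 only. *)
Definition affine_dim (R : realType) (n m : nat) (p : configuration R n m)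
    : nat :=
  \dim (\sum_(i < n) \sum_(j < n) <[p i - p j]>)%VS.

Definition first_order_flex (R : realType) (n m : nat) (e : rel 'I_n)
    (p p' : configuration R n m) : Prop :=
  forall i j, e i j -> dot (p i - p j) (p' i - p' j) = 0.

Definition trivial_flex (R : realType) (n m : nat)
    (p p' : configuration R n m) : Prop :=
  exists (A : 'M[R]_m) (b : 'cV[R]_m),
    A^T = - A /\ forall i, p' i = A *m p i + b.

Definition second_order_flex (R : realType) (n m : nat) (e : rel 'I_n)
    (p p' p'' : configuration R n m) : Prop :=
  first_order_flex e p p' /\
  forall i j, e i j ->
    dot (p i - p j) (p'' i - p'' j) + dot (p' i - p' j) (p' i - p' j) = 0.

Definition second_order_rigid (R : realType) (n m : nat) (e : rel 'I_n)
    (p : configuration R n m) : Prop :=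
  ~ exists p' p'' : configuration R n m,
      second_order_flex e p p' p'' /\ ~ trivial_flex p p'.

Definition equilibrium_stress (R : realType) (n m : nat) (e : rel 'I_n)
    (p : configuration R n m) (w : 'M[R]_n) : Prop :=
  [/\ w^T = w,
      forall i j, ~~ e i j -> w i j = 0 &
      forall i, \sum_(j < n) w i j *: (p i - p j) = 0].

Definition stress_matrix (R : realType) (n : nat) (w : 'M[R]_n) : 'M[R]_n :=
  \matrix_(i, j) (if i == j then \sum_(k < n | k != i) w i k else - w i j).

Definition pos_semidef (R : realType) (n : nat) (M : 'M[R]_n) : Prop :=
  M^T = M /\ forall x : 'cV[R]_n, 0 <= dot x (M *m x).

Definition prestress_stable (R : realType) (n m : nat) (e : rel 'I_n)
    (p : configuration R n m) : Prop :=
  exists w : 'M[R]_n,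
    equilibrium_stress e p w /\
    forall p' : configuration R n m,
      first_order_flex e p p' -> ~ trivial_flex p p' ->
      0 < \sum_(i < n) \sum_(j < n | (i < j)%N)
            w i j * dot (p' i - p' j) (p' i - p' j).

Definition on_conic_at_infinity (R : realType) (n m : nat) (e : rel 'I_n)
    (p : configuration R n m) : Prop :=
  exists Q : 'M[R]_m,
    [/\ Q^T = Q,
        forall i j, e i j -> dot (p i - p j) (Q *m (p i - p j)) = 0 &
        exists k l, ~~ e k l /\ dot (p k - p l) (Q *m (p k - p l)) != 0].

Definition super_stable (R : realType) (n m : nat) (e : rel 'I_n)
    (p : configuration R n m) : Prop :=
  (exists w : 'M[R]_n,
    [/\ equilibrium_stress e p w,
        pos_semidef (stress_matrix w) &
        \rank (stress_matrix w) = (n - affine_dim p - 1)%N]) /\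
  ~ on_conic_at_infinity e p.

(* An inclusion of R^m in R^D is any linear isometric embedding, given by a
   matrix with orthonormal columns; it exists exactly when m <= D. *)
Definition isometric_inclusion (R : realType) (m D : nat) (iota : 'M[R]_(D, m))
    : Prop :=
  iota^T *m iota = 1%:M.

Definition include (R : realType) (n m D : nat) (iota : 'M[R]_(D, m))
    (p : configuration R n m) : configuration R n D :=
  fun i => iota *m p i.

Definition universally_second_order_rigid (R : realType) (n m D : nat)
    (iota : 'M[R]_(D, m)) (e : rel 'I_n) (p : configuration R n m) : Prop :=
  second_order_rigid e (include iota p).

Definition universally_prestress_stable (R : realType) (n m D : nat)
    (iota : 'M[R]_(D, m)) (e : rel 'I_n) (p : configuration R n m) : Prop :=
  prestress_stable e (include iota p).

(* Main.v *)
Require Import Defs.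
From HB Require Import structures.
From mathcomp Require Import all_boot all_order all_algebra.
From mathcomp Require Import reals.
From mathcomp Require Import ring lra.
From mathcomp Require Import topology normedtype derive.
From mathcomp Require boolp classical_sets.

(* A configuration Y of vectors orthogonal to the affine span of q, each of
   whose coordinates is orthogonal to the affine functions of q, is a first-order
   flex, trivial only if Y = 0; so rigidity says that for Y <> 0 the vector of
   squared edge lengths of Y is not in the image of the rigidity map.  Let Y0
   with |Y0| = 1 minimise the norm of its class g0 modulo that image.  Since
   rank Y0 + dim <q> < n <= D, some u <> 0 satisfies Y0 u = 0 and is orthogonal
   to the span, so Y0 + s x u^T has Gram matrix Y0 Y0^T + s^2 |u|^2 x x^T;
   minimality then gives <g0, g(x)> > 0 for all x <> 0 orthogonal to the affine
   functions.  Read as edge weights, g0 is an equilibrium stress whose matrix is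
   definite on that orthogonal complement, which gives the rank.

   A conic Q through the edge directions yields the second-order flex
   (Q q, - Q^2 q), which is trivial by rigidity: this excludes conics at infinity
   and shows that affine flexes, the only ones of zero stress energy, are trivial. *)

Set Implicit Arguments.
Unset Strict Implicit.
Unset Printing Implicit Defensive.

Import Order.TTheory GRing.Theory Num.Theory.
Local Open Scope ring_scope.

(** * The Frobenius inner product on matrices *)

Section MatrixInnerProduct.
Variable R : realType.

Definition mxdot (m n : nat) (A B : 'M[R]_(m, n)) : R := \tr (A^T *m B).

Lemma mxdotE m n (A B : 'M[R]_(m, n)) :
  mxdot A B = \sum_i \sum_j A i j * B i j.
Proof.
rewrite /mxdot /mxtrace exchange_big; apply: eq_bigr => j _.
by rewrite mxE; apply: eq_bigr => i _; rewrite mxE.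
Qed.

Lemma mxdotC m n (A B : 'M[R]_(m, n)) : mxdot A B = mxdot B A.
Proof. by rewrite /mxdot -mxtrace_tr trmx_mul trmxK. Qed.

Lemma mxdotDr m n (A B C : 'M[R]_(m, n)) :
  mxdot A (B + C) = mxdot A B + mxdot A C.
Proof. by rewrite /mxdot mulmxDr mxtraceD. Qed.

Lemma mxdotZr m n (A B : 'M[R]_(m, n)) (a : R) :
  mxdot A (a *: B) = a * mxdot A B.
Proof. by rewrite /mxdot -scalemxAr mxtraceZ. Qed.

Lemma mxdotDl m n (A B C : 'M[R]_(m, n)) :
  mxdot (B + C) A = mxdot B A + mxdot C A.
Proof. by rewrite mxdotC mxdotDr !(mxdotC A). Qed.

Lemma mxdotZl m n (A B : 'M[R]_(m, n)) (a : R) :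
  mxdot (a *: B) A = a * mxdot B A.
Proof. by rewrite mxdotC mxdotZr mxdotC. Qed.

Lemma mxdot_mull m n k (A : 'M[R]_(m, k)) (B : 'M_(m, n)) (C : 'M_(n, k)) :
  mxdot A (B *m C) = mxdot (B^T *m A) C.
Proof. by rewrite /mxdot trmx_mul trmxK mulmxA. Qed.

Lemma mxdot_mulr m n k (A : 'M[R]_(m, k)) (B : 'M_(m, n)) (C : 'M_(n, k)) :
  mxdot A (B *m C) = mxdot (A *m C^T) B.
Proof.
by rewrite /mxdot trmx_mul trmxK mulmxA mxtrace_mulC mulmxA.
Qed.

Lemma mxdot_ge0 m n (A : 'M[R]_(m, n)) : 0 <= mxdot A A.
Proof.
by rewrite mxdotE !sumr_ge0 // => i _; rewrite sumr_ge0 // => j _; rewrite -expr2 sqr_ge0.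
Qed.

Lemma sqr_le_mxdot m n (A : 'M[R]_(m, n)) i j : A i j ^+ 2 <= mxdot A A.
Proof.
have sq_ge0 a b : 0 <= A a b * A a b by rewrite -expr2 sqr_ge0.
rewrite mxdotE (bigD1 i) //= (bigD1 j) //= expr2 -addrA lerDl addr_ge0 //.
  by rewrite sumr_ge0.
by rewrite sumr_ge0 // => a _; rewrite sumr_ge0.
Qed.

Lemma mxdot_eq0 m n (A : 'M[R]_(m, n)) : (mxdot A A == 0) = (A == 0).
Proof.
apply/eqP/eqP => [A0|->]; last by rewrite /mxdot mulmx0 mxtrace0.
apply/matrixP => i j; rewrite mxE; apply/eqP; rewrite -sqrf_eq0 eq_le sqr_ge0 andbT.
by rewrite -A0 sqr_le_mxdot.
Qed.

Lemma mxdot_gt0 m n (A : 'M[R]_(m, n)) : (0 < mxdot A A) = (A != 0).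
Proof. by rewrite lt_def mxdot_ge0 mxdot_eq0 andbT. Qed.

Lemma mxdot_mxvec m n (A B : 'M[R]_(m, n)) :
  mxdot (mxvec A) (mxvec B) = mxdot A B.
Proof.
rewrite !mxdotE big_ord1 pair_bigA /=.
rewrite (reindex _ (curry_mxvec_bij _ _)) /=.
by apply: eq_bigr => -[i j] _; rewrite !mxvecE.
Qed.

Lemma dotE m (u v : 'cV[R]_m) : dot u v = mxdot u v.
Proof. by rewrite /dot /mxdot trace_mx11. Qed.

End MatrixInnerProduct.

(** * Minimising quartic forms on the unit sphere of a subspace *)

Section Compactness.
Import classical_sets numFieldNormedType.Exports.
Local Open Scope classical_set_scope.
Variable R : realType.

Lemma continuous_sum (T : topologicalType) (I : finType) (F : I -> T -> R) :
  (forall i, continuous (F i)) -> continuous (fun x => \sum_i F i x).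
Proof.
by move=> Fc; apply: continuous_big => [|i _]; [exact: add_continuous|exact: Fc].
Qed.

Lemma continuous_mul (T : topologicalType) (f g : T -> R) :
  continuous f -> continuous g -> continuous (fun x => f x * g x).
Proof. by move=> fc gc x; exact: (cvgM (fc x) (gc x)). Qed.

Lemma continuous_mulmx (T : topologicalType) m n k (F : T -> 'M[R]_(m, n))
    (C : 'M[R]_(n, k)) :
  (forall i j, continuous (fun x => F x i j)) ->
  forall i j, continuous (fun x => (F x *m C) i j).
Proof.
move=> Fc i j.
have -> : (fun x => (F x *m C) i j) = (fun x => \sum_l F x i l * C l j).
  by apply/boolp.funext => x; rewrite mxE.
apply: continuous_sum => l; apply: continuous_mul => //; exact: cst_continuous.
Qed.

Lemma continuous_mxdot (T : topologicalType) m n (F : T -> 'M[R]_(m, n)) :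
  (forall i j, continuous (fun x => F x i j)) ->
  continuous (fun x => mxdot (F x) (F x)).
Proof.
move=> Fc.
have -> : (fun x => mxdot (F x) (F x)) =
          (fun x => \sum_i \sum_j F x i j * F x i j).
  by apply/boolp.funext => x; rewrite mxdotE.
by do 2![apply: continuous_sum => ?]; apply: continuous_mul.
Qed.

(** The unit sphere of the kernel of [C] is compact, so [f] attains its minimum there; homogeneity
    of degree 4 carries the bound to every vector of the kernel. *)
Lemma quartic_min N c (C : 'M[R]_(N, c)) (f : 'rV[R]_N -> R) :
  continuous f -> (forall a v, f (a *: v) = a ^+ 4 * f v) ->
  (exists2 v : 'rV[R]_N, v *m C = 0 & v != 0) ->
  exists2 v0 : 'rV[R]_N, v0 *m C = 0 /\ mxdot v0 v0 = 1 &
    forall v : 'rV[R]_N, v *m C = 0 -> f v0 * mxdot v v ^+ 2 <= f v.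
Proof.
move=> fc fZ [v1 v1C v1_neq0].
pose S := [set v : 'rV[R]_N | v *m C = 0 /\ mxdot v v = 1].
have S_unit (v : 'rV[R]_N) : v *m C = 0 -> v != 0 ->
    S ((Num.sqrt (mxdot v v))^-1 *: v).
  move=> vC v_neq0; split; first by rewrite -scalemxAl vC scaler0.
  rewrite mxdotZl mxdotZr mulrA -expr2 exprVn sqr_sqrtr ?mxdot_ge0 //.
  by rewrite mulVf // mxdot_eq0.
have S0 : S !=set0 by eexists; exact: S_unit v1C v1_neq0.
have idc (i : 'I_1) j : continuous (fun v : 'rV[R]_N => v i j).
  exact: coord_continuous.
have Scl : closed S.
  have -> : S = (fun v => mxdot (v *m C) (v *m C)) @^-1` [set x | x = 0] `&`
                (fun v => mxdot v v) @^-1` [set x | x = 1].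
    apply/seteqP; split => v /= [h1 h2]; split => //.
      by rewrite h1 /mxdot mulmx0 mxtrace0.
    by apply/eqP; rewrite -mxdot_eq0 h1.
  apply: closedI; apply: preimage_closed; try exact: closed_eq; move=> v _.
    by apply: continuous_mxdot; exact: continuous_mulmx.
  exact: continuous_mxdot.
have Sb : bounded_set S.
  exists 1; split=> // x x_gt1 v [_ vv1]; apply: ltW; apply: le_lt_trans x_gt1.
  (* The library norm is the sup norm, and each squared entry is at most [mxdot v v = 1]. *)
  rewrite [leLHS]/Num.norm /= mx_normrE; apply/bigmax_leP; split => //= -[i j] _ /=.
  by rewrite -(@ler_pXn2r _ 2) ?nnegrE // expr1n real_normK ?num_real // -vv1 sqr_le_mxdot.
have [v0] := EVT_min_rV S0 (bounded_closed_compact Sb Scl) (continuous_subspaceT fc).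
rewrite inE => v0S v0min; exists v0 => // v vC.
have [->|v_neq0] := eqVneq v 0.
  (* Homogeneity with factor 0 forces [f 0 = 0]. *)
  have := fZ 0 0; rewrite scale0r expr0n mul0r => ->.
  by rewrite /mxdot mulmx0 mxtrace0 expr0n mulr0.
have /mem_set/v0min := S_unit v vC v_neq0.
have sqrt_gt0 : 0 < Num.sqrt (mxdot v v) by rewrite sqrtr_gt0 mxdot_gt0.
rewrite fZ exprVn mulrC ler_pdivlMr ?exprn_gt0 //.
by rewrite (exprM _ 2 2) sqr_sqrtr ?mxdot_ge0.
Qed.

End Compactness.

(** * Symmetric matrices that are definite on a kernel *)

Section DefiniteOnKernel.
Variable R : realType.

(* Solvability of the normal equations [M M^T a = M x]. *)
Lemma ortho_decomp r n (M : 'M[R]_(r, n)) (x : 'cV[R]_n) :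
  exists a : 'cV[R]_r, M *m (x - M^T *m a) = 0.
Proof.
have sMM : (M *m M^T <= M^T)%MS by exact: submxMl.
(* From [v M M^T = 0] follows [|v M|^2 = 0]; hence [M M^T] and [M^T] have the same rank and the same
   row space. *)
have kerE : (kermx (M *m M^T) <= kermx M)%MS.
  apply/rV_subP => v /sub_kermxP vMM; apply/sub_kermxP/eqP.
  by rewrite -mxdot_eq0 mxdot_mulr -mulmxA vMM /mxdot trmx0 mul0mx mxtrace0.
have rankE : \rank (M *m M^T) = \rank M^T.
  apply/eqP; rewrite eqn_leq mxrankS //= mxrank_tr.
  have := mxrankS kerE; rewrite !mxrank_ker leq_sub2lE //; exact: rank_leq_row.
have : (x^T *m M^T <= M *m M^T)%MS.
  apply: submx_trans (submxMl _ _) _.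
  by have /leqifP := mxrank_leqif_sup sMM; rewrite rankE; case: ifP => //; rewrite ltnn.
case/submxP => b bE; exists b^T.
rewrite mulmxBr mulmxA; apply: trmx_inj.
by rewrite linearB /= !trmx_mul !trmxK -bE subrr trmx0.
Qed.

(** Subtracting from [x] its component in the row space of [M] leaves the energy unchanged, since
    [S] kills that space, and puts the remainder in the kernel of [M], where [S] is definite. *)
Lemma definite_on_kernel r n (M : 'M[R]_(r, n)) (S : 'M[R]_n) :
  S^T = S -> S *m M^T = 0 ->
  (forall x : 'cV[R]_n, M *m x = 0 -> x != 0 -> 0 < mxdot x (S *m x)) ->
  [/\ forall x : 'cV[R]_n, 0 <= mxdot x (S *m x),
      forall x : 'cV[R]_n, mxdot x (S *m x) = 0 -> exists a, x = M^T *m a &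
      \rank S = (n - \rank M)%N].
Proof.
move=> S_sym SM0 Spos.
have MS0 : M *m S = 0 by apply: trmx_inj; rewrite trmx_mul S_sym SM0 trmx0.
have energy_split (x : 'cV[R]_n) (a : 'cV[R]_r) (y := x - M^T *m a) :
    mxdot x (S *m x) = mxdot y (S *m y).
  have -> : S *m x = S *m y by rewrite mulmxBr mulmxA SM0 mul0mx subr0.
  have Ma0 : mxdot (M^T *m a) (S *m y) = 0.
    by rewrite mxdotC mxdot_mull trmxK mulmxA MS0 mul0mx /mxdot trmx0 mul0mx mxtrace0.
  by rewrite -{1}(subrK (M^T *m a) x) mxdotDl Ma0 addr0.
have kerS (x : 'cV[R]_n) : mxdot x (S *m x) = 0 -> exists a, x = M^T *m a.
  move=> x0; have [a Ma] := ortho_decomp M x; exists a.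
  have [/eqP|y_neq0] := eqVneq (x - M^T *m a) 0; first by rewrite subr_eq0 => /eqP.
  by have := Spos _ Ma y_neq0; rewrite -energy_split x0 ltxx.
split=> //.
  move=> x; have [a Ma] := ortho_decomp M x; rewrite (energy_split _ a).
  have [->|y_neq0] := eqVneq (x - M^T *m a) 0; last exact/ltW/Spos.
  by rewrite mulmx0 /mxdot mulmx0 mxtrace0.
(* The upper bound on the rank comes from [S *m M^T = 0], the lower one from the kernel of [S] lying
   in the row space of [M]. *)
apply/eqP; rewrite eqn_leq leq_subRL ?rank_leq_col // leq_subLR.
rewrite -(mxrank_tr M) (addnC (\rank M^T)) mulmx0_rank_max //= -leq_subLR -mxrank_ker mxrank_tr.
apply: mxrankS; apply/rV_subP => v /sub_kermxP vS.
have [|a vE] := kerS v^T.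
  by rewrite -S_sym -trmx_mul vS trmx0 /mxdot mulmx0 mxtrace0.
by rewrite -(trmxK v) vE trmx_mul trmxK submxMl.
Qed.

End DefiniteOnKernel.

(** * Stress matrices and the energy of a stress *)

Section StressEnergy.
Variable R : realType.

Definition cfmx n m (p : configuration R n m) : 'M[R]_(n, m) :=
  \matrix_(i, k) p i k 0.

Definition mxcf n m (P : 'M[R]_(n, m)) : configuration R n m :=
  fun i => \col_k P i k.

Lemma mxcfK n m (P : 'M[R]_(n, m)) : cfmx (mxcf P) = P.
Proof. by apply/matrixP => i k; rewrite !mxE. Qed.

Definition edge_dot n m (X Z : 'M[R]_(n, m)) (i j : 'I_n) : R :=
  \sum_k (X i k - X j k) * (Z i k - Z j k).

(** Linear in [Z], this is the rigidity map of [X] up to a constant factor; for [Z = X] it records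
    the squared edge lengths. *)
Definition edge_mx n m (e : rel 'I_n) (X Z : 'M[R]_(n, m)) : 'M[R]_n :=
  \matrix_(i, j) (if e i j then edge_dot X Z i j else 0).

Lemma dot_edge n m (p z : configuration R n m) i j :
  dot (p i - p j) (z i - z j) = edge_dot (cfmx p) (cfmx z) i j.
Proof. by rewrite /dot mxE; apply: eq_bigr => k _; rewrite !mxE. Qed.

Lemma edge_dotC n m (X Z : 'M[R]_(n, m)) i j :
  edge_dot X Z i j = edge_dot X Z j i.
Proof. by apply: eq_bigr => k _; ring. Qed.

Lemma edge_mx_is_linear n m e (X : 'M[R]_(n, m)) : linear (edge_mx e X).
Proof.
move=> a Y Z; apply/matrixP => i j; rewrite !mxE.
case: ifP => _; last by ring.
rewrite /edge_dot mulr_sumr -big_split /=; apply: eq_bigr => k _.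
by rewrite !mxE; ring.
Qed.

HB.instance Definition _ n m e (X : 'M[R]_(n, m)) :=
  GRing.isLinear.Build R 'M[R]_(n, m) 'M[R]_n _ (edge_mx e X)
    (edge_mx_is_linear e X).

Lemma stress_matrix_sym n (w : 'M[R]_n) :
  w^T = w -> (stress_matrix w)^T = stress_matrix w.
Proof.
move=> w_sym; apply/matrixP => i j; rewrite !mxE eq_sym.
case: eqP => [->//|_]; by rewrite -[in LHS]w_sym mxE.
Qed.

Lemma stress_mulE n m (w : 'M[R]_n) (X : 'M[R]_(n, m)) i k :
  (stress_matrix w *m X) i k = \sum_j w i j * (X i k - X j k).
Proof.
rewrite mxE (bigD1 i) //= [RHS](bigD1 i) //= subrr mulr0 add0r mxE eqxx.
rewrite mulr_suml -big_split /=; apply: eq_bigr => j ji.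
by rewrite mxE eq_sym (negbTE ji); ring.
Qed.

Lemma equilibriumP n m e (p : configuration R n m) (w : 'M[R]_n) :
  equilibrium_stress e p w <->
  [/\ w^T = w, forall i j, ~~ e i j -> w i j = 0 &
      stress_matrix w *m cfmx p = 0].
Proof.
have SE i k : (stress_matrix w *m cfmx p) i k =
    (\sum_(j < n) w i j *: (p i - p j)) k 0.
  by rewrite stress_mulE summxE; apply: eq_bigr => j _; rewrite !mxE.
split=> -[h1 h2 h3]; split=> //.
  by apply/matrixP => i k; rewrite SE h3 !mxE.
by move=> i; apply/matrixP => k l; rewrite ord1 -SE h3 !mxE.
Qed.

(** The factor 2 arises because the sum runs over ordered pairs. *)
Lemma stress_energy n m (w : 'M[R]_n) (X Z : 'M[R]_(n, m)) : w^T = w ->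
  \sum_i \sum_j w i j * edge_dot X Z i j = 2 * mxdot Z (stress_matrix w *m X).
Proof.
move=> w_sym; have wC i j : w i j = w j i by rewrite -[in LHS]w_sym mxE.
pose T i j := w i j * \sum_k (X i k - X j k) * Z i k.
have TE i j : w i j * edge_dot X Z i j = T i j + T j i.
  rewrite /T (wC j i) -mulrDr -big_split /=; congr (_ * _).
  by apply: eq_bigr => k _; ring.
under eq_bigr do under eq_bigr do rewrite TE.
under eq_bigr do rewrite big_split /=.
rewrite big_split /= [X in _ + X]exchange_big /= -mulr2n -[LHS]mulr_natl.
congr (_ * _); rewrite mxdotE; apply: eq_bigr => i _.
under [RHS]eq_bigr do rewrite stress_mulE mulr_sumr.
rewrite exchange_big; apply: eq_bigr => j _.
by rewrite /T mulr_sumr; apply: eq_bigr => k _; ring.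
Qed.

Lemma stress_energy_lt n m (w : 'M[R]_n) (X : 'M[R]_(n, m)) : w^T = w ->
  \sum_(i < n) \sum_(j < n | (i < j)%N) w i j * edge_dot X X i j =
  mxdot X (stress_matrix w *m X).
Proof.
move=> w_sym; apply: (@mulfI _ 2); rewrite ?pnatr_eq0 // -stress_energy //.
have wC i j : w i j = w j i by rewrite -[in LHS]w_sym mxE.
pose T (i j : 'I_n) := w i j * edge_dot X X i j.
have T0 i : T i i = 0.
  by rewrite /T /edge_dot big1 ?mulr0 // => k _; rewrite subrr mulr0.
have TC i j : T i j = T j i by rewrite /T edge_dotC (wC j i).
have sum_gt : \sum_(i < n) \sum_(j < n | (j < i)%N) T i j =
              \sum_(i < n) \sum_(j < n | (i < j)%N) T i j.
  rewrite (exchange_big_dep xpredT) //=; apply: eq_bigr => i _.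
  by apply: eq_bigr => j _; exact: TC.
rewrite mulr_natl mulr2n -[X in _ + X]sum_gt -big_split /=.
apply: eq_bigr => i _; rewrite [RHS](bigID (fun j : 'I_n => (i < j)%N)) /=; congr (_ + _).
rewrite [RHS](bigD1 i) ?ltnn //= -/(T i i) T0 add0r; apply: eq_bigl => j.
by rewrite -leqNgt ltn_neqAle andbC.
Qed.

End StressEnergy.

(** * Affine functions and the dimension of the affine span *)

Section AffineSpan.
Variable R : realType.

Definition base_mx n m (X : 'M[R]_(n, m)) (o : 'I_n) : 'M[R]_(n, m) :=
  \matrix_(i, k) (X i k - X o k).

(* The rows of [aff_mx X o] span the affine functions restricted to the rows of X. *)
Definition aff_mx n m (X : 'M[R]_(n, m)) (o : 'I_n) : 'M[R]_(m + 1, n) :=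
  col_mx (base_mx X o)^T (const_mx 1).

(** The coordinate functions based at [o] vanish at [o] while the constant 1 does not, so the
    constants contribute exactly one dimension. *)
Lemma rank_aff_mx n m (X : 'M[R]_(n, m)) o :
  \rank (aff_mx X o) = (\rank (base_mx X o)).+1.
Proof.
rewrite /aff_mx -addsmxE mxrank_disjoint_sum.
  rewrite mxrank_tr rank_rV -[RHS]addn1; congr (_ + _)%N.
  by case: eqP => // /matrixP/(_ 0 o)/eqP; rewrite !mxE oner_eq0.
apply/eqP/rowV0P => v; rewrite sub_capmx => /andP[/submxP[a vE] /sub_rVP[c vc]].
have v0 : v 0 o = 0.
  by rewrite vE mxE big1 // => k _; rewrite !mxE subrr mulr0.
by move: v0; rewrite vc !mxE mulr1 => ->; rewrite scale0r.
Qed.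

Lemma rank_base_mx_lt n m (X : 'M[R]_(n, m)) o : (\rank (base_mx X o) < n)%N.
Proof. by rewrite -rank_aff_mx rank_leq_col. Qed.

Lemma mulmx_aff_mx_eq0 n m k (X : 'M[R]_(n, m)) o (Y : 'M[R]_(n, k)) :
  aff_mx X o *m Y = 0 -> X^T *m Y = 0 /\ (const_mx 1 : 'rV_n) *m Y = 0.
Proof.
rewrite /aff_mx mul_col_mx -[0]vsubmxK linear0 linear0 => /eq_col_mx[XY oneY].
split=> //; suff -> : X = base_mx X o + (const_mx 1)^T *m row o X.
  by rewrite linearD /= mulmxDl XY trmx_mul trmxK -mulmxA oneY mulmx0 addr0.
by apply/matrixP => i k'; rewrite !mxE big_ord1 !mxE; ring.
Qed.

(** A basis of the direction space, written as the rows of a row-free matrix [B], has the same row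
    space as the differences from [o]. *)
Lemma affine_dimE n m (p : configuration R n m) o :
  affine_dim p = \rank (base_mx (cfmx p) o).
Proof.
rewrite /affine_dim; set U := (\sum_i _)%VS.
pose B : 'M[R]_(\dim U, m) := \matrix_(k, l) (vbasis U)`_k l 0.
have sum_B (c : 'I_(\dim U) -> R) l :
    (\sum_k c k *: (vbasis U)`_k) l 0 = ((\row_k c k) *m B) 0 l.
  by rewrite summxE mxE; apply: eq_bigr => k _; rewrite !mxE.
have diffU i j : p i - p j \in U.
  have := memv_line (p i - p j).
  by apply: subvP; apply: (sumv_sup i) => //; apply: (sumv_sup j).
have B_free : row_free B.
  rewrite -kermx_eq0; apply/rowV0P => v /sub_kermxP vB.
  have /freeP b_free := basis_free (vbasisP U).
  apply/rowP => k; rewrite mxE; apply: b_free.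
  apply/matrixP => l z; rewrite ord1 sum_B.
  have -> : \row_k0 v 0 k0 = v by apply/rowP => k0; rewrite mxE.
  by rewrite vB !mxE.
have U_sub (u : 'cV[R]_m) : u \in U -> (u^T <= base_mx (cfmx p) o)%MS.
  case/memv_sumP => us us_in ->; rewrite linear_sum; apply: summx_sub => i _.
  case/memv_sumP: (us_in i isT) => ts ts_in ->.
  rewrite linear_sum; apply: summx_sub => j _.
  case/vlineP: (ts_in j isT) => c ->; rewrite linearZ /= scalemx_sub //.
  suff -> : (p i - p j)^T = row i (base_mx (cfmx p) o) - row j (base_mx (cfmx p) o).
    by rewrite addmx_sub ?eqmx_opp ?row_sub.
  by apply/rowP => k; rewrite !mxE; ring.
rewrite -(eqP B_free); apply: eqmx_rank; apply/andP; split; apply/row_subP => i.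
  have -> : row i B = ((vbasis U)`_i)^T by apply/rowP => l; rewrite !mxE.
  by apply: U_sub; apply: vbasis_mem; rewrite mem_nth ?size_tuple.
have -> : row i (base_mx (cfmx p) o) =
    (\row_k coord (vbasis U) k (p i - p o)) *m B.
  apply/rowP => l; rewrite -sum_B -coord_vbasis //; by rewrite !mxE.
exact: submxMl.
Qed.

End AffineSpan.

(** * The obstruction to extending a flex to second order *)

Section Obstruction.
Variable R : realType.

(** As [t] tends to 0 the terms of first order give [f0 * a <= b]; a single small [t] suffices for
    the sign. *)
Lemma gt0_of_quadratic_ineq (f0 a b c : R) :
  0 < f0 -> 0 < a -> 0 <= c ->
  (forall t, 0 < t -> f0 * (1 + t * a) ^+ 2 <= f0 + 2 * t * b + t ^+ 2 * c) ->
  0 < b.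
Proof.
move=> f0_gt0 a_gt0 c_ge0 ineq; rewrite ltNge; apply/negP => b_le0.
have c1_gt0 : 0 < c + 1 by rewrite ltr_pwDr.
(* With this [t], [b <= 0] would give [2 * t * f0 * a <= t^2 * c <= t * f0 * a]; the 1 added to [c]
   keeps the denominator positive. *)
pose t := f0 * a / (c + 1).
have t_gt0 : 0 < t by rewrite divr_gt0 ?mulr_gt0.
have tc : t * (c + 1) = f0 * a by rewrite divfK // gt_eqF.
have ht := ineq t t_gt0.
have tb : t * b <= 0 by rewrite pmulr_rle0.
have fta : 0 <= f0 * (t * a) ^+ 2 by rewrite mulr_ge0 ?sqr_ge0 // ltW.
have tt : 0 < t ^+ 2 by rewrite exprn_gt0.
have : 2 * t * (f0 * a) <= t * (f0 * a) by rewrite -tc; nra.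
have : 0 < t * (f0 * a) by rewrite mulr_gt0 // mulr_gt0.
lra.
Qed.

Variables (n D : nat) (e : rel 'I_n).

Definition rigidity_mx (X : 'M[R]_(n, D)) : 'M[R]_(n * D, n * n) :=
  lin_mx (edge_mx e X).

(* The class of the squared edge lengths of [Y] modulo the image of the
   rigidity map: it vanishes iff a first-order flex [Y] extends to second order. *)
Definition obstruction m (X : 'M[R]_(n, D)) (Y : 'M[R]_(n, m)) : 'rV[R]_(n * n) :=
  mxvec (edge_mx e Y Y) *m cokermx (rigidity_mx X).

Lemma obstruction_eq0 (X Y : 'M[R]_(n, D)) :
  obstruction X Y = 0 -> exists Z, edge_mx e X Z = edge_mx e Y Y.
Proof.
move/eqP; rewrite -submxE => /submxP[z zE]; exists (vec_mx z).
by apply: (can_inj mxvecK); rewrite zE -mul_vec_lin vec_mxK.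
Qed.

Lemma obstructionZ m X (Y : 'M[R]_(n, m)) a :
  obstruction X (a *: Y) = a ^+ 2 *: obstruction X Y.
Proof.
rewrite /obstruction scalemxAl -linearZ; congr (mxvec _ *m _).
apply/matrixP => i j; rewrite !mxE; case: ifP => _; last by ring.
rewrite /edge_dot mulr_sumr; apply: eq_bigr => k _; by rewrite !mxE; ring.
Qed.

(** The squared lengths split because every cross term contains a factor [Y *m u = 0]. *)
Lemma obstruction_add_rank1 m X (Y : 'M[R]_(n, m)) (x : 'cV[R]_n)
    (u : 'cV[R]_m) s : Y *m u = 0 ->
  obstruction X (Y + s *: (x *m u^T)) =
  obstruction X Y + (s ^+ 2 * mxdot u u) *: obstruction X x.
Proof.
move=> Yu; rewrite /obstruction [in RHS]scalemxAl -[in RHS]linearZ -mulmxDl -linearD.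
congr (mxvec _ *m _).
apply/matrixP => i j; rewrite !mxE; case: ifP => _; last by ring.
have Yu0 a : \sum_k Y a k * u k 0 = 0.
  by move/matrixP/(_ a 0): Yu; rewrite !mxE.
have cross : \sum_k (Y i k - Y j k) * u k 0 = 0.
  by under eq_bigr do rewrite mulrBl; rewrite sumrB !Yu0 subrr.
have -> : mxdot u u = \sum_k u k 0 * u k 0.
  by rewrite mxdotE; apply: eq_bigr => k _; rewrite big_ord1.
rewrite /edge_dot big_ord1.
transitivity (\sum_k (Y i k - Y j k) * (Y i k - Y j k) +
  (2 * s * (x i 0 - x j 0)) * (\sum_k (Y i k - Y j k) * u k 0) +
  (s ^+ 2 * (\sum_k u k 0 * u k 0) * ((x i 0 - x j 0) * (x i 0 - x j 0)))).
  rewrite [s ^+ 2 * _ * _]mulrAC !mulr_sumr -!big_split /=; apply: eq_bigr => k _.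
  by rewrite !mxE !big_ord1 !mxE; ring.
by rewrite cross mulr0 addr0.
Qed.

Lemma mxdot_add_rank1 m (Y : 'M[R]_(n, m)) (x : 'cV[R]_n) (u : 'cV[R]_m) s :
  Y *m u = 0 ->
  mxdot (Y + s *: (x *m u^T)) (Y + s *: (x *m u^T)) =
  mxdot Y Y + s ^+ 2 * mxdot u u * mxdot x x.
Proof.
move=> Yu; rewrite !mxdotDr !mxdotDl !mxdotZl !mxdotZr (mxdotC _ Y).
have -> : mxdot Y (x *m u^T) = 0.
  by rewrite mxdot_mulr trmxK Yu /mxdot trmx0 mul0mx mxtrace0.
have -> : mxdot (x *m u^T) (x *m u^T) = mxdot u u * mxdot x x.
  rewrite mxdot_mulr trmxK -mulmxA [u^T *m u]mx11_scalar mul_mx_scalar mxdotZl.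
  by rewrite /mxdot -trace_mx11.
by ring.
Qed.

Import numFieldNormedType.Exports.

Lemma obstruction_continuous (X : 'M[R]_(n, D)) :
  continuous (fun v : 'rV[R]_(n * D) =>
    mxdot (obstruction X (vec_mx v)) (obstruction X (vec_mx v)) : R).
Proof.
apply: continuous_mxdot; apply: continuous_mulmx => i k.
case/mxvec_indexP: k => k l.
have -> : (fun v : 'rV[R]_(n * D) => mxvec (edge_mx e (vec_mx v) (vec_mx v)) i (mxvec_index k l)) =
  (fun v => (e k l)%:R * edge_dot (vec_mx v) (vec_mx v) k l).
  apply/boolp.funext => v; rewrite ord1 mxvecE mxE; case: ifP => _; rewrite ?mul1r ?mul0r //.
apply: continuous_mul; first exact: cst_continuous.
apply: continuous_sum => h.
have entry_c a : continuous (fun v : 'rV[R]_(n * D) => vec_mx v a h : R).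
  have -> : (fun v : 'rV[R]_(n * D) => vec_mx v a h) = (fun v => v 0 (mxvec_index a h)).
    by apply/boolp.funext => v; rewrite mxE.
  exact: coord_continuous.
have diff_c : continuous (fun v : 'rV[R]_(n * D) => vec_mx v k h - vec_mx v l h : R).
  by move=> v; apply: continuousB; exact: entry_c.
exact: continuous_mul.
Qed.

End Obstruction.

(** * Construction of the definite stress *)

Section DefiniteStress.
Variable R : realType.

Lemma rank_lt_exists_ker r m (A : 'M[R]_(r, m)) :
  (\rank A < m)%N -> exists2 u : 'cV[R]_m, A *m u = 0 & u != 0.
Proof.
move=> rA; have : kermx A^T != 0.
  by rewrite -mxrank_eq0 mxrank_ker mxrank_tr subn_eq0 -ltnNge.
case/rowV0Pn => v /sub_kermxP vA v_neq0; exists v^T; last by rewrite trmx_eq0.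
by apply: trmx_inj; rewrite trmx_mul trmxK trmx0.
Qed.

Variables (n D : nat) (e : rel 'I_n).

Lemma orthogonal_flex_obstruction (q : configuration R n D) (o : 'I_n)
    (Y : 'M[R]_(n, D)) :
  second_order_rigid e q -> Y *m (base_mx (cfmx q) o)^T = 0 ->
  aff_mx (cfmx q) o *m Y = 0 -> obstruction e (cfmx q) Y = 0 -> Y = 0.
Proof.
move=> rigid YP MY /obstruction_eq0[Z ZE].
have [XY oneY] := mulmx_aff_mx_eq0 MY.
have first_order i j : edge_dot (cfmx q) Y i j = 0.
  have YP0 a b : \sum_k (cfmx q b k - cfmx q o k) * Y a k = 0.
    transitivity ((Y *m (base_mx (cfmx q) o)^T) a b); last by rewrite YP mxE.
    by rewrite [RHS]mxE; apply: eq_bigr => k _; rewrite mulrC !mxE.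
  (* Expanding around [o] leaves only products of rows of [Y] with directions of the span, all
     zero. *)
  transitivity (\sum_k (cfmx q i k - cfmx q o k) * Y i k
              - \sum_k (cfmx q i k - cfmx q o k) * Y j k
              - \sum_k (cfmx q j k - cfmx q o k) * Y i k
              + \sum_k (cfmx q j k - cfmx q o k) * Y j k).
    by rewrite /edge_dot -!sumrB -big_split /=; apply: eq_bigr => k _; ring.
  by rewrite !YP0 !subr0 addr0.
(* The sign of [Z] is reversed because the second-order equation asks for a sum equal to zero. *)
have flexY : second_order_flex e q (mxcf Y) (mxcf (- Z)).
  split=> i j eij; rewrite !dot_edge !mxcfK //.
  move/matrixP/(_ i j): ZE; rewrite !mxE eij => <-.
  by rewrite /edge_dot -big_split big1 //= => k _; rewrite !mxE; ring.
have [A [b [_ YE]]] : trivial_flex q (mxcf Y).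
  by apply: boolp.contrapT => nontriv; apply: rigid; exists (mxcf Y), (mxcf (- Z)).
have {}YE : Y = cfmx q *m A^T + (const_mx 1 : 'rV_n)^T *m b^T.
  apply/matrixP => i k; have /matrixP/(_ k 0) := YE i.
  rewrite !mxE big_ord1 !mxE mul1r => ->; congr (_ + _).
  by apply: eq_bigr => l _; rewrite !mxE mulrC.
(* Triviality makes the columns of [Y] affine functions of [q], to which [Y] is orthogonal; so [Y]
   is orthogonal to itself. *)
apply/eqP; rewrite -mxdot_eq0 {2}YE mxdotDr !mxdot_mull trmxK XY oneY.
by rewrite /mxdot !trmx0 !mul0mx !mxtrace0 addr0.
Qed.

Theorem definite_stress (q : configuration R n D) (o : 'I_n) :
  symmetric e -> (n <= D)%N -> second_order_rigid e q ->
  exists2 w : 'M[R]_n, equilibrium_stress e q w &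
    forall x : 'cV[R]_n, aff_mx (cfmx q) o *m x = 0 -> x != 0 ->
      0 < mxdot x (stress_matrix w *m x).
Proof.
move=> e_sym n_le_D rigid.
set X := cfmx q; set P := base_mx X o; set M := aff_mx X o.
have rP : (\rank P < n)%N := rank_base_mx_lt X o.
(* If only 0 is orthogonal to the affine functions, definiteness is vacuous and the zero stress
   serves. *)
have [K0|/rowV0Pn[x1 /sub_kermxP x1M x1_neq0]] := eqVneq (kermx M^T) 0.
  exists 0.
    by split=> [||i]; rewrite ?trmx0 // => *; rewrite ?big1 ?mxE // => *; rewrite mxE scale0r.
  move=> x Mx x_neq0; case/negP: x_neq0; rewrite -trmx_eq0 -submx0 -K0.
  by apply/sub_kermxP; rewrite -trmx_mul Mx trmx0.
pose C := row_mx (lin_mx (mulmxr P^T)) (lin_mx (mulmx M)).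
have CP (Y : 'M[R]_(n, D)) : mxvec Y *m C = 0 <-> Y *m P^T = 0 /\ M *m Y = 0.
  rewrite mul_mx_row !mul_vec_lin /=; split=> [|[-> ->]]; last first.
    by rewrite !linear0 row_mx0.
  rewrite -[0]hsubmxK !linear0 => /eq_row_mx[YP MY].
  by split; apply: (can_inj mxvecK); rewrite linear0.
pose f (v : 'rV[R]_(n * D)) : R :=
  mxdot (obstruction e X (vec_mx v)) (obstruction e X (vec_mx v)).
have fZ a v : f (a *: v) = a ^+ 4 * f v.
  by rewrite /f linearZ obstructionZ mxdotZl mxdotZr mulrA -exprD.
(* A product of a vector orthogonal to the affine functions and a vector orthogonal to the span
   meets both constraints. *)
have exY : exists2 v : 'rV[R]_(n * D), v *m C = 0 & v != 0.
  have [u Pu u_neq0] := rank_lt_exists_ker (leq_trans rP n_le_D).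
  exists (mxvec (x1^T *m u^T)).
    apply/CP; split; first by rewrite -mulmxA -trmx_mul Pu trmx0 mulmx0.
    by rewrite mulmxA -[M]trmxK -trmx_mul x1M trmx0 mul0mx.
  rewrite mxvec_eq0 -mxdot_eq0 mxdot_mulr trmxK -mulmxA [u^T *m u]mx11_scalar.
  rewrite mul_mx_scalar mxdotZl mulf_eq0 -trace_mx11 -/(mxdot u u).
  by rewrite !mxdot_eq0 trmx_eq0 negb_or u_neq0.
have [v0 [v0C v0_norm] v0min] := quartic_min (@obstruction_continuous R n D e X) fZ exY.
pose Y0 := vec_mx v0; pose g0 := obstruction e X Y0.
have {v0C} [Y0P MY0] : Y0 *m P^T = 0 /\ M *m Y0 = 0 by apply/CP; rewrite vec_mxK.
have Y0_norm : mxdot Y0 Y0 = 1 by rewrite -mxdot_mxvec vec_mxK.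
have Ymin (Y : 'M[R]_(n, D)) : Y *m P^T = 0 -> M *m Y = 0 ->
    mxdot g0 g0 * mxdot Y Y ^+ 2 <= mxdot (obstruction e X Y) (obstruction e X Y).
  move=> YP MY; have := v0min (mxvec Y); rewrite mxvecK mxdot_mxvec; apply.
  exact/CP.
have g0_gt0 : 0 < mxdot g0 g0.
  rewrite mxdot_gt0; apply/eqP => g00.
  have Y00 : Y0 = 0 by exact: orthogonal_flex_obstruction rigid Y0P MY0 g00.
  by move: Y0_norm; rewrite Y00 /mxdot mulmx0 mxtrace0 => /eqP; rewrite eq_sym oner_eq0.
(* [M *m Y0 = 0] gives [rank Y0 + rank P + 1 <= n], and [n <= D] leaves room for [u]. *)
have [u YPu u_neq0] : exists2 u : 'cV[R]_D, col_mx Y0 P *m u = 0 & u != 0.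
  apply: rank_lt_exists_ker; rewrite -addsmxE; apply: leq_ltn_trans (mxrank_adds_leqif _ _).1 _.
  apply: leq_trans n_le_D.
  by have := mulmx0_rank_max MY0; rewrite rank_aff_mx addSn addnC.
have [Yu Pu] : Y0 *m u = 0 /\ P *m u = 0.
  by move: YPu; rewrite mul_col_mx -[0]vsubmxK !linear0 => /eq_col_mx.
have obs_pos (x : 'cV[R]_n) : M *m x = 0 -> x != 0 -> 0 < mxdot g0 (obstruction e X x).
  move=> Mx x_neq0.
  (* Minimality is tested on [Y0 + s *: (x *m u^T)], with [s] chosen so that [t = s^2 |u|^2]. *)
  apply: (gt0_of_quadratic_ineq g0_gt0 (a := mxdot x x)
           (c := mxdot (obstruction e X x) (obstruction e X x))).
  - by rewrite mxdot_gt0.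
  - exact: mxdot_ge0.
  move=> t t_gt0; pose s := Num.sqrt (t / mxdot u u).
  have uu_gt0 : 0 < mxdot u u by rewrite mxdot_gt0.
  have sE : s ^+ 2 * mxdot u u = t.
    by rewrite sqr_sqrtr ?divfK ?gt_eqF // divr_ge0 ?ltW.
  have := Ymin (Y0 + s *: (x *m u^T)).
  rewrite mxdot_add_rank1 // obstruction_add_rank1 // sE Y0_norm -/g0.
  rewrite mxdotDr !mxdotDl !mxdotZl !mxdotZr (mxdotC _ g0).
  set rhs := (X in _ -> _ -> _ <= X).
  have -> : rhs = mxdot g0 g0 + 2 * t * mxdot g0 (obstruction e X x)
      + t ^+ 2 * mxdot (obstruction e X x) (obstruction e X x) by rewrite /rhs; ring.
  apply.
    by rewrite mulmxDl Y0P -scalemxAl -mulmxA -trmx_mul Pu trmx0 mulmx0 scaler0 addr0.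
  by rewrite mulmxDr MY0 -scalemxAr mulmxA Mx mul0mx scaler0 addr0.
(* [W] is [g0] pulled back along the adjoint of the cokernel map, so it annihilates the image of the
   rigidity map. *)
pose W := vec_mx (g0 *m (cokermx (rigidity_mx e X))^T) : 'M[R]_n.
have WE (A : 'M[R]_n) : mxdot W A = mxdot g0 (mxvec A *m cokermx (rigidity_mx e X)).
  by rewrite mxdot_mulr -(mxdot_mxvec W) /W vec_mxK.
(* Symmetrising without halving matches the factor 2 in [stress_energy]. *)
pose w := \matrix_(i, j) (if e i j then W i j + W j i else 0) : 'M[R]_n.
have w_sym : w^T = w.
  by apply/matrixP => i j; rewrite !mxE e_sym addrC.
have wE m (Y Z : 'M[R]_(n, m)) :
    mxdot Z (stress_matrix w *m Y) = mxdot W (edge_mx e Y Z).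
  apply: (@mulfI _ 2); rewrite ?pnatr_eq0 // -stress_energy //.
  rewrite mxdotE mulr_natl mulr2n -[X in _ = X + _]exchange_big -big_split /=.
  apply: eq_bigr => i _; rewrite -big_split /=; apply: eq_bigr => j _.
  rewrite !mxE e_sym (edge_dotC _ _ j i); case: ifP => _; ring.
exists w.
  apply/equilibriumP; split=> //.
    by move=> i j /negbTE eij; rewrite mxE eij.
  (* The squared norm of [stress_matrix w *m X] is a pairing of [W] with an element of the image of
     the rigidity map. *)
  apply/eqP; rewrite -mxdot_eq0 wE WE -mul_vec_lin -mulmxA mulmx_coker mulmx0.
  by rewrite /mxdot mulmx0 mxtrace0.
by move=> x Mx x_neq0; rewrite wE WE obs_pos.
Qed.

End DefiniteStress.

(** * Conics at infinity and affine flexes *)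

Section Conics.
Variable R : realType.

Lemma mxdot_skew m (A : 'M[R]_m) (v : 'cV[R]_m) : A^T = - A -> mxdot v (A *m v) = 0.
Proof.
move=> A_skew; apply/eqP.
have : mxdot v (A *m v) = - mxdot v (A *m v).
  by rewrite {1}mxdot_mull A_skew mulNmx -scaleN1r mxdotZl mxdotC mulN1r.
lra.
Qed.

(** For an edge vector [v], symmetry of [Q] makes [v . (- Q^2 v)] cancel [|Q v|^2]. *)
Lemma conic_flex_trivial n m e (q : configuration R n m) (Q : 'M[R]_m) :
  second_order_rigid e q -> Q^T = Q ->
  (forall i j, e i j -> dot (q i - q j) (Q *m (q i - q j)) = 0) ->
  trivial_flex q (fun i => Q *m q i).
Proof.
move=> rigid Q_sym conic; apply: boolp.contrapT => nontriv; apply: rigid.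
exists (fun i => Q *m q i), (fun i => - (Q *m (Q *m q i))); split=> //.
split=> i j eij; first by rewrite -mulmxBr conic.
have -> : - (Q *m (Q *m q i)) - - (Q *m (Q *m q j)) = - (Q *m (Q *m (q i - q j))).
  by rewrite !mulmxBr opprB opprK addrC.
rewrite -mulmxBr !dotE.
rewrite -[- (_ *m _)]scaleN1r mxdotZr (mxdot_mull (q i - q j)) Q_sym; ring.
Qed.

(** On all differences of points [Q] agrees with a skew matrix, whose quadratic form vanishes. *)
Lemma not_on_conic n m e (q : configuration R n m) :
  second_order_rigid e q -> ~ on_conic_at_infinity e q.
Proof.
move=> rigid [Q [Q_sym conic [k [l [_ /eqP]]]]]; apply.
have [A [b [A_skew AE]]] := conic_flex_trivial rigid Q_sym conic.
have -> : Q *m (q k - q l) = A *m (q k - q l).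
  by rewrite !mulmxBr !AE opprD addrACA subrr addr0.
by rewrite dotE mxdot_skew.
Qed.

(** The symmetric part [Q] of [A] satisfies the conic equations on edges, so its flex is trivial;
    the remaining part [A - Q] is skew. *)
Lemma affine_flex_trivial n m e (q p' : configuration R n m) (A : 'M[R]_m) b :
  second_order_rigid e q -> first_order_flex e q p' ->
  (forall i, p' i = A *m q i + b) -> trivial_flex q p'.
Proof.
move=> rigid flex p'E; pose Q := 2^-1 *: (A + A^T).
have Q_sym : Q^T = Q by rewrite linearZ linearD /= trmxK addrC.
have conic i j : e i j -> dot (q i - q j) (Q *m (q i - q j)) = 0.
  move=> /flex; rewrite !p'E opprD addrACA subrr addr0 -mulmxBr !dotE => Av.
  rewrite -scalemxAl mxdotZr mulmxDl mxdotDr (mxdot_mull _ A^T) trmxK.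
  by rewrite (mxdotC (A *m _)) Av addr0 mulr0.
have [S [c [S_skew SE]]] := conic_flex_trivial rigid Q_sym conic.
exists (S + (A - Q)), (c + b); split.
  rewrite linearD /= S_skew linearB /= Q_sym opprD; congr (_ + _).
  apply/matrixP => i j; rewrite !mxE; lra.
by move=> i; rewrite p'E mulmxDl mulmxBl addrACA -SE addrA subrKC.
Qed.

End Conics.

(** * From a definite stress to prestress stability *)

Section Consequences.
Variables (R : realType) (n m : nat) (e : rel 'I_n).

Lemma stress_matrix_aff (w : 'M[R]_n) (X : 'M[R]_(n, m)) o :
  stress_matrix w *m X = 0 -> stress_matrix w *m (aff_mx X o)^T = 0.
Proof.
move=> SX; rewrite /aff_mx tr_col_mx mul_mx_row trmxK.
have -> : stress_matrix w *m base_mx X o = stress_matrix w *m X.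
  apply/matrixP => i k; rewrite !stress_mulE; apply: eq_bigr => j _.
  by rewrite !mxE; ring.
have -> : stress_matrix w *m (const_mx 1 : 'rV_n)^T = 0.
  apply/matrixP => i k; rewrite stress_mulE big1 ?mxE // => j _.
  by rewrite !mxE subrr mulr0.
by rewrite SX row_mx0.
Qed.

Lemma col_mulmx r k l (A : 'M[R]_(r, k)) (B : 'M[R]_(k, l)) j :
  col j (A *m B) = A *m col j B.
Proof. by rewrite !colE mulmxA. Qed.

Lemma mxdot_cols k (X Y : 'M[R]_(n, k)) :
  mxdot X Y = \sum_j mxdot (col j X) (col j Y).
Proof.
rewrite mxdotE exchange_big; apply: eq_bigr => j _.
by rewrite mxdotE; apply: eq_bigr => i _; rewrite big_ord1 !mxE.
Qed.

(** The energy is a sum of nonnegative terms, one per coordinate; if it vanishes, every coordinate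
    of the flex is an affine function of [q]. *)
Lemma definite_stress_prestress (q : configuration R n m) o (w : 'M[R]_n) :
  second_order_rigid e q -> equilibrium_stress e q w ->
  (forall x : 'cV[R]_n, 0 <= mxdot x (stress_matrix w *m x)) ->
  (forall x : 'cV[R]_n, mxdot x (stress_matrix w *m x) = 0 ->
     exists a, x = (aff_mx (cfmx q) o)^T *m a) ->
  prestress_stable e q.
Proof.
move=> rigid stress psd ker; exists w; split=> // p' flex nontriv.
have [w_sym _ _] := stress.
under eq_bigr do under eq_bigr do rewrite dot_edge.
rewrite stress_energy_lt // mxdot_cols.
under eq_bigr do rewrite col_mulmx.
rewrite lt_def sumr_ge0 ?andbT => [|k _]; last exact: psd.
apply/negP => /eqP/psumr_eq0P energy0; apply: nontriv.
have /submxP[B BE] : ((cfmx p')^T <= aff_mx (cfmx q) o)%MS.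
  apply/row_subP => k; rewrite -tr_col.
  have [|a ->] := ker (col k (cfmx p')); first by apply: energy0.
  by rewrite trmx_mul trmxK submxMl.
(* The translation is corrected by the base point, since [aff_mx] uses differences from [q o]. *)
apply: (@affine_flex_trivial _ _ _ _ _ _ (lsubmx B) (rsubmx B - lsubmx B *m q o)) flex _ => //.
move=> i; rewrite addrCA -mulmxBr addrC.
have -> : p' i = col i (cfmx p')^T by apply/colP => k; rewrite !mxE.
rewrite BE -{1}(hsubmxK B) mul_row_col linearD /= !col_mulmx; congr (_ *m _ + _).
  by apply/colP => k; rewrite !mxE.
by apply/colP => k; rewrite !mxE big_ord1 !mxE mulr1.
Qed.

End Consequences.

(** * Passing between the ambient space and the larger one *)

Section Inclusion.
Variables (R : realType) (n m D : nat) (iota : 'M[R]_(D, m)).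
Hypothesis iota_incl : isometric_inclusion iota.

Lemma cfmx_include (p : configuration R n m) :
  cfmx (include iota p) = cfmx p *m iota^T.
Proof.
apply/matrixP => i k; rewrite !mxE; apply: eq_bigr => l _.
by rewrite !mxE mulrC.
Qed.

Lemma affine_dim_include (p : configuration R n m) (o : 'I_n) :
  affine_dim (include iota p) = affine_dim p.
Proof.
rewrite !(affine_dimE _ o) cfmx_include.
rewrite -(@mxrankMfree _ _ _ _ (base_mx (cfmx p) o) iota^T); last first.
  by apply/row_freeP; exists iota.
congr (\rank _); apply/matrixP => i k; rewrite !mxE -sumrB.
by apply: eq_bigr => l _; rewrite !mxE; ring.
Qed.

(** The left inverse [iota^T] of the inclusion projects the equilibrium equations back. *)
Lemma equilibrium_stress_include e (p : configuration R n m) w :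
  equilibrium_stress e (include iota p) w -> equilibrium_stress e p w.
Proof.
case/equilibriumP => w_sym w_supp; rewrite cfmx_include mulmxA => S0.
apply/equilibriumP; split=> //.
by rewrite -[LHS]mulmx1 -iota_incl mulmxA S0 mul0mx.
Qed.

End Inclusion.

Theorem corollary4p8 (R : realType) (n m d D : nat) (e : rel 'I_n)
    (p : configuration R n m) (iota : 'M[R]_(D, m))
    (n_gt0 : (0 < n)%N) (e_graph : simple_graph e)
    (p_dim : affine_dim p = d)
    (d_lt_D : (d < D)%N) (n_le_D : (n <= D)%N)
    (iota_incl : isometric_inclusion iota)
    (p_rigid : universally_second_order_rigid iota e p) :
  [/\ exists w : 'M[R]_n,
        [/\ equilibrium_stress e p w,
            pos_semidef (stress_matrix w) &
            \rank (stress_matrix w) = (n - d - 1)%N],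
      super_stable e (include iota p) &
      universally_prestress_stable iota e p].
Proof.
pose o := Ordinal n_gt0.
have q_dim : affine_dim (include iota p) = d by rewrite (affine_dim_include _ _ o).
have [w w_stress w_pos] := definite_stress o e_graph.1 n_le_D p_rigid.
have [w_sym _ SX] := (equilibriumP _ _ _).1 w_stress.
have [psd ker rkS] := definite_on_kernel (stress_matrix_sym w_sym)
  (stress_matrix_aff o SX) w_pos.
have w_psd : pos_semidef (stress_matrix w).
  by split=> [|x]; [exact: stress_matrix_sym | rewrite dotE].
have w_rank : \rank (stress_matrix w) = (n - d - 1)%N.
  (* The constant functions account for the final 1 in [n - d - 1]. *)
  by rewrite rkS rank_aff_mx -affine_dimE q_dim -subnDA addn1.
split.
- by exists w; split=> //; exact: equilibrium_stress_include w_stress.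
- by split; [exists w; rewrite q_dim | exact: not_on_conic].
- exact: definite_stress_prestress p_rigid w_stress psd ker.
Qed.
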